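(* Let $G$ be an archimedean totally ordered group. Then the semigroups $\mathbf{End}^o(G)$ and $\mathbf{End}(\mathscr{B}^+(G))$ are isomorphic.
   Context: A totally ordered group is a group $G$ (written multiplicatively, with identity $e$) with a total order $\leqslant$ such that $a\leqslant b$ implies $ag\leqslant bg$ and $ga\leqslant gb$ for all $a,b,g\in G$. Its positive cone is $G^+=\{x\in G: e\leqslant x\}$. It is archimedean if for all $a,b\in G^+\setminus\{e\}$ there is a positive integer $n$ with $a\leqslant b^n$ (archimedean totally ordered groups are commutative). An $o$-endomorphism of $G$ is an order-preserving group homomorphism $G\to G$; $\mathbf{End}^o(G)$ is the semigroup of all $o$-endomorphisms of $G$ under composition. The bicyclic extension $\mathscr{B}^+(G)$ of $G$ is the monoid with underlying set $G^+\times G^+$, identity $(e,e)$ and operation $$(a,b)(c,d)=\begin{cases}(a b^{-1} c,\,d), & b<c,\\ (a,d), & b=c,\\ (a,\,b c^{-1} d), & b>c.\end{cases}$$ $\mathbf{End}(\mathscr{B}^+(G))$ is the semigroup, under composition, of all monoid endomorphisms of $\mathscr{B}^+(G)$ (multiplicative maps sending $(e,e)$ to $(e,e)$). Composition is taken in the same order in both semigroups. *)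

(* Defs.v *)
From HB Require Import structures.
From mathcomp Require Import all_boot all_order.
From mathcomp Require Import boolp.

Set Implicit Arguments.
Unset Strict Implicit.
Unset Printing Implicit Defensive.

Import Order.TTheory.

Local Open Scope order_scope.
Local Open Scope group_scope.

HB.mixin Record isOrderedGroup (d : Order.disp_t) G
    of Group G & Order.Total d G := {
  oleM2r : forall g a b : G, a <= b -> a * g <= b * g;
  oleM2l : forall g a b : G, a <= b -> g * a <= g * b
}.

#[short(type="toGroupType")]
HB.structure Definition TOGroup (d : Order.disp_t) :=
  {G of Group G & Order.Total d G & isOrderedGroup d G}.

HB.mixin Record isArchimedeanGroup (d : Order.disp_t) G of TOGroup d G := {
  archimedeanP : forall a b : G, 1 < a -> 1 < b ->
    exists n : nat, (0 < n)%N /\ a <= b ^+ n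
}.

#[short(type="archGroupType")]
HB.structure Definition ArchGroup (d : Order.disp_t) :=
  {G of TOGroup d G & isArchimedeanGroup d G}.

Section OrderedGroupTheory.
Variables (d : Order.disp_t) (G : toGroupType d).
Implicit Types a b c g : G.

Lemma ole_pM2r g a b : (a * g <= b * g) = (a <= b).
Proof. by apply/idP/idP => [/(oleM2r g^-1)|/oleM2r//]; rewrite !mulgK. Qed.

Lemma ole_pM2l g a b : (g * a <= g * b) = (a <= b).
Proof. by apply/idP/idP => [/(oleM2l g^-1)|/oleM2l//]; rewrite !mulKg. Qed.

Lemma olt_pM2r g a b : (a * g < b * g) = (a < b).
Proof. by rewrite !ltNge ole_pM2r. Qed.

Lemma olt_pM2l g a b : (g * a < g * b) = (a < b).
Proof. by rewrite !ltNge ole_pM2l. Qed.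

Lemma omul_ge1 a b : 1 <= a -> 1 <= b -> 1 <= a * b.
Proof. by move=> a1 b1; apply: (le_trans a1); rewrite -{1}[a]mulg1 ole_pM2l. Qed.

Lemma odivl_ge1 a b : (1 <= a^-1 * b) = (a <= b).
Proof. by rewrite -(ole_pM2l a 1) mulg1 mulVKg. Qed.

Lemma odivr_ge1 a b : (1 <= a * b^-1) = (b <= a).
Proof. by rewrite -(ole_pM2r b 1) mul1g mulgVK. Qed.

Lemma odivl_gt1 a b : (1 < a^-1 * b) = (a < b).
Proof. by rewrite -(olt_pM2l a 1) mulg1 mulVKg. Qed.

Lemma odivr_gt1 a b : (1 < a * b^-1) = (b < a).
Proof. by rewrite -(olt_pM2r b 1) mul1g mulgVK. Qed.

Lemma omaxMl g a b : g * Order.max a b = Order.max (g * a) (g * b).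
Proof. by rewrite !maxElt olt_pM2l; case: ifP. Qed.

End OrderedGroupTheory.

Section ArchimedeanCommutative.
Variables (d : Order.disp_t) (G : archGroupType d).
Implicit Types a b c e x : G.

Lemma arch_floor e x : 1 < e -> 1 <= x ->
  exists n, e ^+ n <= x /\ x < e ^+ n.+1.
Proof.
move=> e1 x1.
have exP : exists n, x < e ^+ n.
  move: x1; rewrite le_eqVlt => /orP[/eqP <-|x1]; first by exists 1%N.
  have [n [_ xn]] := archimedeanP _ _ x1 e1.
  exists n.+1; apply: (le_lt_trans xn).
  by rewrite expgSr -{1}[e ^+ n]mulg1 olt_pM2l.
case: (ex_minnP exP) => -[|n] xn nmin; first by move: xn; rewrite ltNge x1.
exists n; split=> //; rewrite leNgt; apply/negP => /nmin.
by rewrite ltnn.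
Qed.

Lemma arch_mulgC_gt1 a b : 1 < a -> 1 < b -> a * b <= b * a.
Proof.
move=> a1 b1.
have [[e [e1 emin]]|dense] :=
  pselect (exists e : G, 1 < e /\ forall x, 1 < x -> e <= x).
  have cyc x : 1 < x -> exists n, x = e ^+ n.
    move=> x1; have [n [nx xn]] := arch_floor e1 (ltW x1).
    exists n; apply/eqP; rewrite eq_le nx andbT leNgt; apply/negP.
    rewrite -odivl_gt1 => /emin.
    by rewrite -(ole_pM2l (e ^+ n)) mulVKg -expgSr leNgt xn.
  have [n ->] := cyc a a1; have [m ->] := cyc b b1.
  by rewrite -!expgnDr addnC.
rewrite leNgt; apply/negP => ltba.
set e := (b * a)^-1 * (a * b).
have e1 : 1 < e by rewrite odivl_gt1.
have [x [x1 xe]] : exists x, 1 < x /\ x * x <= e.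
  have [x x1 xe] : exists2 x, 1 < x & x < e.
    apply: contrapT => nx; apply: dense; exists e; split=> // x x1.
    by rewrite leNgt; apply/negP => xe; apply: nx; exists x.
  have [xxe|exx] := leP (x * x) e; first by exists x.
  exists (e * x^-1); split; first by rewrite odivr_gt1.
  apply/ltW; rewrite -{3}(mulgVK x e) olt_pM2l.
  by rewrite -(olt_pM2r x) mulgVK.
have [m [ma am]] := arch_floor x1 (ltW a1).
have [n [nb bn]] := arch_floor x1 (ltW b1).
have ab_lt : a * b < x ^+ (n + m) * (x * x).
  apply: (@lt_trans _ _ (a * x ^+ n.+1)); first by rewrite olt_pM2l.
  have -> : x ^+ (n + m) * (x * x) = x ^+ m.+1 * x ^+ n.+1.
    by rewrite mulgA -!expgSr -expgnDr addSn addnS addnC.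
  by rewrite olt_pM2r.
have : x ^+ (n + m) * (x * x) <= a * b.
  apply: (@le_trans _ _ (x ^+ (n + m) * e)); first by rewrite ole_pM2l.
  have -> : a * b = b * a * e by rewrite mulVKg.
  rewrite ole_pM2r expgnDr.
  by apply: (@le_trans _ _ (b * x ^+ m)); rewrite ?ole_pM2l ?ole_pM2r.
by rewrite leNgt ab_lt.
Qed.

Lemma arch_mulgC a b : a * b = b * a.
Proof.
have C x y : 1 < x -> 1 < y -> commute x y.
  by move=> x1 y1; apply/eqP; rewrite eq_le !arch_mulgC_gt1.
have V x : x < 1 -> 1 < x^-1 by move=> x1; rewrite -[x^-1]mulg1 odivl_gt1.
have CV x y : commute x^-1 y -> commute x y.
  by move=> /commute_sym/commuteV; rewrite invgK => /commute_sym.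
have C1 x y : 1 < x -> commute x y.
  move=> x1; case: (ltgtP y 1) => [/V y1|y1|->]; last exact: commute1.
    by apply: commute_sym; apply: CV; apply: commute_sym; apply: C.
  exact: C.
case: (ltgtP a 1) => [/V a1|a1|->]; first exact/CV/C1.
  exact: C1.
by rewrite mulg1 mul1g.
Qed.

End ArchimedeanCommutative.

Definition poscone (d : Order.disp_t) (G : toGroupType d) : Type :=
  {x : G | 1 <= x}.

HB.instance Definition _ (d : Order.disp_t) (G : toGroupType d) :=
  SubChoice.on (poscone G).

(* An alias of the product type: the multiplication below is not the
   componentwise one. *)
Definition bicyclic (d : Order.disp_t) (G : toGroupType d) : Type :=
  (poscone G * poscone G)%type.

HB.instance Definition _ (d : Order.disp_t) (G : toGroupType d) :=
  Choice.on (bicyclic G).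

Section Bicyclic.
Variables (d : Order.disp_t) (G : toGroupType d).
Implicit Types x y : bicyclic G.

Definition bicyclic_op (u v : G * G) : G * G :=
  let: (a, b) := u in
  let: (c, d) := v in
  if b < c then (a * b^-1 * c, d)
  else if b == c then (a, d)
  else (a, b * c^-1 * d).

Fact bicyclic_op_ge1 x y :
  let u := bicyclic_op (val x.1, val x.2) (val y.1, val y.2) in
  (1 <= u.1) /\ (1 <= u.2).
Proof.
case: x y => [[a a1] [b b1]] [[c c1] [e e1]] /=.
case: ltgtP => [bc|cb|_] //=; split=> //.
  by rewrite -mulgA; apply: omul_ge1 => //; rewrite odivl_ge1 ltW.
by apply: omul_ge1 => //; rewrite odivr_ge1 ltW.
Qed.

Definition bicyclic_mul x y : bicyclic G :=
  (Sub _ (bicyclic_op_ge1 x y).1 : poscone G,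
   Sub _ (bicyclic_op_ge1 x y).2 : poscone G).

Definition bicyclic_one : bicyclic G :=
  (Sub 1 (lexx 1) : poscone G, Sub 1 (lexx 1) : poscone G).

Definition bicyclic_val x : G * G := (val x.1, val x.2).

Lemma bicyclic_val_inj : injective bicyclic_val.
Proof.
by move=> [a b] [c e] [ac be]; congr pair; apply: val_inj.
Qed.

Lemma bicyclic_val_mul x y :
  bicyclic_val (bicyclic_mul x y) = bicyclic_op (bicyclic_val x) (bicyclic_val y).
Proof. exact: esym (surjective_pairing _). Qed.

Lemma bicyclic_op_max (a b c e : G) :
  bicyclic_op (a, b) (c, e) =
    (a * b^-1 * Order.max b c, Order.max b c * c^-1 * e).
Proof.
by rewrite /=; case: ltgtP => [bc|cb|->]; rewrite ?mulgVK ?mulgV ?mul1g.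
Qed.

Fact bicyclic_mul1g : left_id bicyclic_one bicyclic_mul.
Proof.
move=> [a b]; apply: bicyclic_val_inj; rewrite bicyclic_val_mul.
rewrite bicyclic_op_max max_r ?(valP a) //.
by rewrite invg1 !mulg1 mul1g mulgV mul1g.
Qed.

Fact bicyclic_mulg1 : right_id bicyclic_one bicyclic_mul.
Proof.
move=> [a b]; apply: bicyclic_val_inj; rewrite bicyclic_val_mul.
by rewrite bicyclic_op_max max_l ?(valP b) // invg1 mulgVK !mulg1.
Qed.

HB.instance Definition _ := hasMul.Build (bicyclic G) bicyclic_mul.
HB.instance Definition _ :=
  Magma_isUMagma.Build (bicyclic G) bicyclic_mul1g bicyclic_mulg1.

End Bicyclic.

(* With a b^-1 c (rather than c b^-1 a) as first component, associativity
   relies on the commutativity of G, which arch_mulgC derives from the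
   archimedean property. *)
Section BicyclicArchimedean.
Variables (d : Order.disp_t) (G : archGroupType d).

Fact bicyclic_mulgA : associative (@bicyclic_mul d G).
Proof.
move=> x y z; apply: bicyclic_val_inj; rewrite !bicyclic_val_mul.
case: (bicyclic_val x) (bicyclic_val y) (bicyclic_val z) => a b [c e] [p q].
rewrite !bicyclic_op_max.
have C := @arch_mulgC d G.
set m := Order.max b c; set n := Order.max e p.
have En : c * e^-1 * n = Order.max c (c * e^-1 * p).
  by rewrite /n omaxMl mulgVK.
have Em : Order.max (m * c^-1 * e) p = (e * c^-1) * Order.max b (c * e^-1 * n).
  rewrite En maxA -/m omaxMl.
  by rewrite -mulgA [m * _]C [c^-1 * e]C !mulgA !mulgVK mulgV mul1g.
rewrite Em; set l := Order.max b _; congr pair.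
  by rewrite -[m * c^-1 * e]mulgA [m * _]C mulgKA [c^-1 * e]C mulgA mulgVK.
by rewrite invgM invgF [n^-1 * _]C -!mulgA mulKg !mulgA -[l * e * _]mulgA [l * _]C.
Qed.

HB.instance Definition _ :=
  UMagma_isMonoid.Build (bicyclic G) bicyclic_mulgA.

End BicyclicArchimedean.

HB.structure Definition OGroupMorphism d (G : toGroupType d)
    d' (H : toGroupType d') :=
  {f of @UMagmaMorphism G H f & @Order.OrderMorphism d G d' H f}.

Section OGroupMorphismComp.
Variables (d1 d2 d3 : Order.disp_t).
Variables (G : toGroupType d1) (H : toGroupType d2) (K : toGroupType d3).
Variables (f : OGroupMorphism.type H K) (g : OGroupMorphism.type G H).

HB.instance Definition _ := UMagmaMorphism.on (f \o g).
HB.instance Definition _ := Order.OrderMorphism.on (f \o g).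

End OGroupMorphismComp.

Definition oEnd (d : Order.disp_t) (G : toGroupType d) : Type :=
  OGroupMorphism.type G G.

Section OEnd.
Variables (d : Order.disp_t) (G : toGroupType d).
Implicit Types f g h : oEnd G.

Lemma oEnd_eq f g :
  (f : OGroupMorphism.type G G) =1 (g : OGroupMorphism.type G G) -> f = g.
Proof.
case: f g => [f cf] [g cg] /= /funext fg.
case: _ / fg in cg *; congr OGroupMorphism.Pack.
case: cf cg => [[?] [?] [?]] [[?] [?] [?]].
by congr OGroupMorphism.Class; congr (_ _); apply: Prop_irrelevance.
Qed.

Definition oEnd_mul f g : oEnd G :=
  (f : OGroupMorphism.type G G) \o (g : OGroupMorphism.type G G)
  : OGroupMorphism.type G G.

Fact oEnd_mulgA : associative oEnd_mul.
Proof. by move=> f g h; apply: oEnd_eq. Qed.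

(* semigroupType extends choiceType; on types of functions the choice
   structure comes from classical choice. *)
HB.instance Definition _ := gen_eqMixin (oEnd G).
HB.instance Definition _ := gen_choiceMixin (oEnd G).
HB.instance Definition _ := isSemigroup.Build (oEnd G) oEnd_mulgA.

End OEnd.

Definition mEnd (M : monoidType) : Type := UMagmaMorphism.type M M.

Section MEnd.
Variable M : monoidType.
Implicit Types f g h : mEnd M.

Lemma mEnd_eq f g :
  (f : UMagmaMorphism.type M M) =1 (g : UMagmaMorphism.type M M) -> f = g.
Proof.
case: f g => [f cf] [g cg] /= /funext fg.
case: _ / fg in cg *; congr UMagmaMorphism.Pack.
case: cf cg => [[?] [?]] [[?] [?]].
by congr UMagmaMorphism.Class; congr (_ _); apply: Prop_irrelevance.
Qed.

Definition mEnd_mul f g : mEnd M :=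
  (f : UMagmaMorphism.type M M) \o (g : UMagmaMorphism.type M M)
  : UMagmaMorphism.type M M.

Fact mEnd_mulgA : associative mEnd_mul.
Proof. by move=> f g h; apply: mEnd_eq. Qed.

HB.instance Definition _ := gen_eqMixin (mEnd M).
HB.instance Definition _ := gen_choiceMixin (mEnd M).
HB.instance Definition _ := isSemigroup.Build (mEnd M) mEnd_mulgA.

End MEnd.

Definition semigroup_isomorphic (S T : semigroupType) : Prop :=
  exists f : {multiplicative S -> T}, bijective f.

(* Main.v *)
Require Import Defs.
From mathcomp Require Import all_boot all_order.
From HB Require Import structures.
From mathcomp Require Import boolp.

Set Implicit Arguments.
Unset Strict Implicit.
Unset Printing Implicit Defensive.

Import Order.TTheory.

Local Open Scope order_scope.
Local Open Scope group_scope.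

(** An element of G is determined by its fractions a b^-1 with a, b >= 1, and
an element of the bicyclic extension by its factorization
(a, b) = (a, 1) (1, b).  An o-endomorphism f acts on the extension by
(a, b) |-> (f a, f b), because the multiplication only involves the group
operations and maxima, all of which f preserves.

Conversely let phi be a monoid endomorphism.  For a >= 1 the relation
(1, a) (a, 1) = (1, 1) is preserved by phi, and a product u v is the identity
only when u = (1, t) and v = (t, 1) for a common t (bicyclic_mul_eq1).  Hence
phi (1, a) = (1, F a) and phi (a, 1) = (F a, 1) with the same function F, so
that phi (a, b) = (F a, F b) by the factorization.  Since
(1, a) (1, b) = (1, a b), the map F is multiplicative on the positive cone.  As
G is commutative, F extends to a homomorphism of G by
a b^-1 |-> F a (F b)^-1, and the extension preserves the order because F takes
values >= 1 (oEnd_extension).  The extension is unique, so f |-> (f, f) is a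
bijection, and (f, f) composed with (g, g) is (f g, f g). *)

(** * Endomorphisms of the group and its positive cone *)

Section PositiveCone.
Variables (d : Order.disp_t) (G : toGroupType d).
Implicit Types a b x y : G.

Definition pospart x : G := Order.max 1 x.

Lemma pospart_ge1 x : 1 <= pospart x.
Proof. by rewrite le_max lexx. Qed.

Lemma pospart_id x : 1 <= x -> pospart x = x.
Proof. exact: max_r. Qed.

Lemma pospart_frac x : x = pospart x * (pospart x^-1)^-1.
Proof.
have [x1|/ltW x1] := leP 1 x.
  rewrite pospart_id // /pospart max_l ?invg1 ?mulg1 //.
  by rewrite -(ole_pM2l x) mulgV mulg1.
rewrite /pospart max_l // max_r ?invgK ?mul1g //.
by rewrite -(ole_pM2l x) mulgV mulg1.
Qed.

Lemma oEnd_ge1 (f : OGroupMorphism.type G G) a : 1 <= a -> 1 <= f a.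
Proof. by move=> /(omorph_le f); rewrite gmulf1. Qed.

Lemma oEnd_max (f : OGroupMorphism.type G G) :
  {morph f : x y / Order.max x y}.
Proof.
move=> x y; have [xy|/ltW yx] := leP x y.
  by rewrite max_r // omorph_le.
by rewrite max_l // omorph_le.
Qed.

Lemma oEnd_ext (f g : oEnd G) :
  (forall a, 1 <= a -> (f : OGroupMorphism.type G G) a =
                       (g : OGroupMorphism.type G G) a) -> f = g.
Proof.
move=> fg; apply: oEnd_eq => x.
have fracE (h : OGroupMorphism.type G G) :
    h x = h (pospart x) * (h (pospart x^-1))^-1.
  by rewrite [x in LHS]pospart_frac gmulfM gmulfV.
by rewrite !fracE !fg ?pospart_ge1.
Qed.

End PositiveCone.

Section Extension.
Variables (d : Order.disp_t) (G : archGroupType d) (F : G -> G).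
Hypothesis FM : forall a b, 1 <= a -> 1 <= b -> F (a * b) = F a * F b.
Hypothesis F_ge1 : forall a, 1 <= a -> 1 <= F a.

(** The extension of F to fractions, evaluated at the canonical fraction of x
given by pospart_frac. *)
Definition frac_ext (x : G) : G := F (pospart x) * (F (pospart x^-1))^-1.

(** The value does not depend on the fraction: for x = a b^-1, with positive part
p and negative part n, commutativity turns p n^-1 = a b^-1 into the equation
p b = a n in the positive cone, where F is multiplicative. *)
Lemma frac_extE a b : 1 <= a -> 1 <= b ->
  frac_ext (a * b^-1) = F a * (F b)^-1.
Proof.
move=> a1 b1; rewrite /frac_ext; set x := a * b^-1.
have p1 := pospart_ge1 x; have n1 := pospart_ge1 x^-1.
have E : pospart x * b = a * pospart x^-1.
  have xb : x * b = a by rewrite mulgVK.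
  rewrite -xb -mulgA [b * _]arch_mulgC mulgA; congr (_ * _).
  by apply: (mulIg (pospart x^-1)^-1); rewrite mulgK -pospart_frac.
have /(congr1 F) := E; rewrite !FM // => {}E.
apply: (mulIg (F b)); rewrite mulgVK -mulgA [_^-1 * _]arch_mulgC mulgA E.
by rewrite mulgK.
Qed.

Lemma frac_ext_id a : 1 <= a -> frac_ext a = F a.
Proof.
move=> a1; rewrite -[a in LHS]mulg1 -invg1 frac_extE //.
have F1 : F 1 = 1 by apply: (mulIg (F 1)); rewrite -FM // mulg1 mul1g.
by rewrite F1 invg1 mulg1.
Qed.

Fact frac_ext_is_monoid_morphism : monoid_morphism frac_ext.
Proof.
split.
  by rewrite -{1}(mulgV 1) frac_extE // mulgV.
move=> x y; rewrite [x in LHS]pospart_frac [y in LHS]pospart_frac.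
set a := pospart x; set b := pospart x^-1.
set c := pospart y; set e := pospart y^-1.
have -> : a * b^-1 * (c * e^-1) = (a * c) * (b * e)^-1.
  rewrite invgM [e^-1 * _]arch_mulgC -!mulgA; congr (_ * _).
  by rewrite !mulgA [b^-1 * _]arch_mulgC.
rewrite frac_extE ?omul_ge1 ?pospart_ge1 // !FM ?pospart_ge1 // /frac_ext.
rewrite -/a -/b -/c -/e invgM [(F e)^-1 * _]arch_mulgC -!mulgA; congr (_ * _).
by rewrite !mulgA [(F b)^-1 * _]arch_mulgC.
Qed.

HB.instance Definition _ :=
  isUMagmaMorphism.Build G G frac_ext frac_ext_is_monoid_morphism.

Fact frac_ext_mono : {homo frac_ext : x y / x <= y}.
Proof.
move=> x y; rewrite -odivr_ge1 => yx1.
by rewrite -odivr_ge1 -gmulfV -gmulfM /= frac_ext_id // F_ge1.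
Qed.

HB.instance Definition _ :=
  Order.isOrderMorphism.Build d G d G frac_ext frac_ext_mono.

Lemma oEnd_extension :
  exists f : OGroupMorphism.type G G, forall a, 1 <= a -> f a = F a.
Proof. by exists frac_ext; apply: frac_ext_id. Qed.

End Extension.

(** * Factorizations in the bicyclic extension *)

Section BicyclicEnd.
Variables (d : Order.disp_t) (G : archGroupType d).
Implicit Types (a b c e t : G) (x y : bicyclic G).

Local Notation bval := (@bicyclic_val d G).

Lemma bval_mul x y : bval (x * y) = bicyclic_op (bval x) (bval y).
Proof. exact: bicyclic_val_mul. Qed.

Lemma bval_ge1 x : 1 <= (bval x).1 /\ 1 <= (bval x).2.
Proof. by split; [apply: (valP x.1)|apply: (valP x.2)]. Qed.

(** Pairs of elements of G serve as coordinates on the extension, which avoids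
carrying positivity proofs; a coordinate that is not >= 1 is replaced by 1. *)
Definition bic a b : bicyclic G :=
  (insubd (Sub 1 (lexx 1)) a : poscone G, insubd (Sub 1 (lexx 1)) b : poscone G).

Lemma bicK a b : 1 <= a -> 1 <= b -> bval (bic a b) = (a, b).
Proof. by move=> a1 b1; rewrite /bicyclic_val /= !insubdK. Qed.

Lemma bvalK x : bic (bval x).1 (bval x).2 = x.
Proof.
have [? ?] := bval_ge1 x.
by apply: bicyclic_val_inj; rewrite bicK // -surjective_pairing.
Qed.

Lemma bic_factor a b : 1 <= a -> 1 <= b -> bic a 1 * bic 1 b = bic a b.
Proof.
move=> a1 b1; apply: bicyclic_val_inj.
by rewrite bval_mul !bicK //= ltxx eqxx.
Qed.

Lemma bic1_cancel a : 1 <= a -> bic 1 a * bic a 1 = 1.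
Proof.
move=> a1; apply: bicyclic_val_inj.
by rewrite bval_mul !bicK //= ltxx eqxx.
Qed.

Lemma bic1_mul a b : 1 <= a -> 1 <= b -> bic 1 a * bic 1 b = bic 1 (a * b).
Proof.
move=> a1 b1; apply: bicyclic_val_inj.
rewrite bval_mul !bicK ?omul_ge1 // bicyclic_op_max max_l //.
by rewrite invg1 mulg1 mul1g mulVg.
Qed.

(** The components of (a, b) (c, e) are a (b^-1 m) and (m c^-1) e with
m = max b c; all four factors are >= 1, so both products can be 1 only if
every factor is, which forces b = m = c. *)
Lemma bicyclic_mul_eq1 x y : x * y = 1 ->
  exists2 t, 1 <= t & x = bic 1 t /\ y = bic t 1.
Proof.
move=> xy1; have [a1 b1] := bval_ge1 x; have [c1 e1] := bval_ge1 y.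
have eq1 u v : 1 <= u -> 1 <= v -> u * v = 1 :> G -> u = 1 /\ v = 1.
  move=> u1 v1 uv; have {}u1 : u = 1.
    apply: le_anti; rewrite u1 andbT.
    by rewrite -uv -[X in X <= _]mulg1 ole_pM2l.
  by split=> //; rewrite -uv u1 mul1g.
have := congr1 bval xy1; rewrite bval_mul.
rewrite -[x]bvalK -[y]bvalK !bicK // bicyclic_op_max.
move: (bval x).1 (bval x).2 (bval y).1 (bval y).2 a1 b1 c1 e1 => a b c e.
set m := Order.max b c => a1 b1 c1 e1.
case; rewrite -mulgA => /eq1[]//.
  by rewrite odivl_ge1 le_max lexx.
move=> -> bm /eq1[]//.
  by rewrite odivr_ge1 le_max lexx orbT.
move=> cm ->; exists m; first by rewrite le_max b1.
split; congr bic.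
  by apply: (mulgI b^-1); rewrite bm mulVg.
by apply: (mulIg c^-1); rewrite cm mulgV.
Qed.

(** * From o-endomorphisms to endomorphisms of the extension *)

Section Diag.
Variable f : OGroupMorphism.type G G.

Definition diag_fun x : bicyclic G := bic (f (bval x).1) (f (bval x).2).

Lemma bval_diag x : bval (diag_fun x) = (f (bval x).1, f (bval x).2).
Proof. by have [? ?] := bval_ge1 x; rewrite bicK ?oEnd_ge1. Qed.

Fact diag_is_monoid_morphism : monoid_morphism diag_fun.
Proof.
split.
  by apply: bicyclic_val_inj; rewrite bval_diag /= gmulf1.
move=> x y; apply: bicyclic_val_inj; rewrite bval_diag !bval_mul !bval_diag.
case: (bval x) (bval y) => a b [c e]; rewrite !bicyclic_op_max.
by rewrite -oEnd_max !gmulfM !gmulfV.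
Qed.

HB.instance Definition _ :=
  isUMagmaMorphism.Build _ _ diag_fun diag_is_monoid_morphism.

Definition diag_end : UMagmaMorphism.type (bicyclic G) (bicyclic G) := diag_fun.

End Diag.

Definition diag (f : oEnd G) : mEnd (bicyclic G) := diag_end f.

Fact diag_mul : {morph diag : f g / f * g}.
Proof.
move=> f g; apply: mEnd_eq => x; apply: bicyclic_val_inj.
by rewrite /= !bval_diag.
Qed.

HB.instance Definition _ := isMultiplicative.Build _ _ diag diag_mul.

Lemma diag_inj : injective diag.
Proof.
move=> f g fg; apply: oEnd_ext => a a1.
have /(congr1 (fun h : mEnd (bicyclic G) =>
  bval ((h : UMagmaMorphism.type _ _) (bic a 1)))) := fg.
by rewrite /= !bval_diag bicK // => -[].
Qed.

(** * Every endomorphism of the extension is diagonal *)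

(** The images of (1, a) and (a, 1) have product 1, so bicyclic_mul_eq1 puts them
in the form (1, F a) and (F a, 1); these elements generate the extension. *)
Lemma diag_surj (phi : mEnd (bicyclic G)) : exists f, diag f = phi.
Proof.
pose p : UMagmaMorphism.type (bicyclic G) (bicyclic G) := phi.
pose F a := (bval (p (bic 1 a))).2.
have F1 a : 1 <= F a by have [] := bval_ge1 (p (bic 1 a)).
have pF a : 1 <= a -> p (bic 1 a) = bic 1 (F a) /\ p (bic a 1) = bic (F a) 1.
  move=> a1; have := congr1 p (bic1_cancel a1); rewrite gmulfM gmulf1.
  move=> /bicyclic_mul_eq1[t t1 [pa ->]].
  by rewrite /F pa bicK.
have FM a b : 1 <= a -> 1 <= b -> F (a * b) = F a * F b.
  move=> a1 b1; rewrite {1}/F -bic1_mul // gmulfM.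
  by rewrite (pF a a1).1 (pF b b1).1 bic1_mul // bicK ?omul_ge1.
have [f fF] := oEnd_extension FM (fun a _ => F1 a).
exists f; apply: mEnd_eq => x; have [a1 b1] := bval_ge1 x.
rewrite /= /diag_fun !fF //; symmetry.
change (p x = bic (F (bval x).1) (F (bval x).2)).
rewrite -[x in LHS]bvalK -bic_factor // gmulfM.
by rewrite (pF _ a1).2 (pF _ b1).1 bic_factor.
Qed.

End BicyclicEnd.

Theorem mainTheorem2 (d : Order.disp_t) (G : archGroupType d) :
  semigroup_isomorphic (oEnd G) (mEnd (bicyclic G)).
Proof.
exists (@diag d G).
have [g gK] := choice (@diag_surj d G).
by exists g => // f; apply: diag_inj; rewrite gK.
Qed.
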